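(* Let $X$ be a smooth irregular compact Kähler variety with irregularity $q=q(X)$, let $1\le k\le q$, and let $\mathbb{G}=Gr(k,H^0(X,\Omega_X^1))$ with tautological subbundle $S$. Suppose that the complex $$0\to \mathrm{Sym}^2 S\to S\otimes H^0(X,\Omega_X^1)\to H^0(X,\Omega_X^2)\otimes\mathcal{O}_{\mathbb{G}}\to\mathcal{F}\to 0,$$ where $\mathcal{F}$ is the cokernel of the preceding map, is everywhere exact (exact on the fibre over every point of $\mathbb{G}$, so that $\mathcal{F}$ is a vector bundle). Let $\mu$ be the partition $(q-k-1,q-k-2,\ldots,q-2k)$ if $q\ge 2k$, and $(q-k-1,q-k-2,\ldots,1,0,\ldots,0)$ if $q<2k$, and suppose that, in the expansion of the total Chern class $c(\mathcal{F})$ in Schubert classes of $\mathbb{G}$, the coefficient of $\sigma_\lambda$ is zero for every partition $\lambda$ bigger than $\mu$, while the coefficient of $\sigma_\mu$ is non-zero. Then $$h^{2,0}(X)\ge\begin{cases}\binom{q}{2} & \text{if } q\le 2k,\\[2pt] 2kq-\binom{2k+1}{2} & \text{if } q\ge 2k.\end{cases}$$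
   Context: $X$ is a complex smooth projective (or more generally compact Kähler) variety, connected, with $q(X)=h^0(X,\Omega^1_X)>0$; $V=H^0(X,\Omega^1_X)$, $h^{2,0}(X)=h^0(X,\Omega_X^2)$. $\mathbb{G}=Gr(k,V)$ is the Grassmannian of $k$-dimensional subspaces of $V$ and $S\subset\mathbb{G}\times V$ is the tautological subbundle, whose fibre over $W$ is $W$. Over the point $W\in\mathbb{G}$ the complex is $$0\to\mathrm{Sym}^2W\to W\otimes H^0(X,\Omega^1_X)\to H^0(X,\Omega_X^2),$$ with maps $w_1w_2\mapsto w_2\otimes w_1+w_1\otimes w_2$ and $w\otimes\alpha\mapsto w\wedge\alpha$. For a partition $\lambda=(q-k\ge\lambda_1\ge\cdots\ge\lambda_k\ge 0)$, $\sigma_\lambda$ is the cohomology class of the Schubert cycle $\Sigma_\lambda=\{W\in\mathbb{G}\mid\dim(W\cap\langle v_1,\ldots,v_{q-k+i-\lambda_i}\rangle)\ge i \text{ for all } i\}$, for any basis $v_1,\ldots,v_q$ of $V$. A partition $(\lambda_1\ge\cdots\ge\lambda_k)$ is bigger than $(\mu_1\ge\cdots\ge\mu_k)$ if $\lambda_i\ge\mu_i$ for all $i$, with strict inequality for some $i$. In both cases of the claim, $\mu_i=\max\{q-k-i,0\}$ for $1\le i\le k$. *)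

(* Defs.v *)
From HB Require Import structures.
From mathcomp Require Import all_boot all_order all_algebra complex.
From mathcomp Require Import all_classical all_reals all_analysis.
Set Implicit Arguments.
Unset Strict Implicit.
Unset Printing Implicit Defensive.
Import Order.TTheory GRing.Theory Num.Theory numFieldNormedType.Exports.
Local Open Scope classical_set_scope.
Local Open Scope ring_scope.

(* The complex numbers, as an abstract [numClosedFieldType] so that the
   norm topology of MathComp-Analysis applies to them; [differentiable]
   between normed modules over [CC R] is then holomorphy. *)
Definition CC (R : realType) : numClosedFieldType := R[i].

(** * Complex manifolds *)

(* [cinv i] matters only on the image of the [i]-th chart. *)
Record cmanifold (R : realType) (n : nat) := CManifold {
  cpt :> topologicalType;
  cidx : Type;
  cdom : cidx -> set cpt;
  cmap : cidx -> cpt -> 'rV[CC R]_n;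
  cinv : cidx -> 'rV[CC R]_n -> cpt;
  cpt_hausdorff : hausdorff_space cpt;
  cdom_open : forall i, open (cdom i);
  cimg_open : forall i, open (cmap i @` cdom i);
  cdom_cover : forall x, exists i, cdom i x;
  cmapK : forall i x, cdom i x -> cinv i (cmap i x) = x;
  cmap_continuous : forall i x, cdom i x -> {for x, continuous (cmap i)};
  cinv_continuous : forall i z,
    (cmap i @` cdom i) z -> {for z, continuous (cinv i)};
  ctrans_holomorphic : forall i j z, (cmap i @` cdom i) z ->
    cdom j (cinv i z) -> differentiable (cmap j \o cinv i) z
}.

Section Manifold.
Context {R : realType} {n : nat} (X : cmanifold R n).
Local Notation C := (CC R).

Definition cimg (i : cidx X) : set 'rV[C]_n := cmap i @` cdom i.

Definition ctrans (i j : cidx X) : 'rV[C]_n -> 'rV[C]_n := cmap j \o cinv i.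

(* [overlap i j z]: the point with coordinate [z] in chart [i] is also in
   the domain of chart [j]. *)
Definition overlap (i j : cidx X) (z : 'rV[C]_n) : Prop :=
  cimg i z /\ cdom j (cinv i z).

(* Tensor fields are given by their components in every chart.  Requiring
   them to vanish outside the image of the chart makes equality of fields
   the equality of functions. *)
Definition cfield (M : Type) := cidx X -> 'rV[C]_n -> M.

(* A 1-form [sum_a f_a dz_a] has the column [f] as components: its value on
   a tangent row vector [u] is [u *m f].  As MathComp-Analysis Jacobians act
   on row vectors on the right, pull-back is multiplication by the Jacobian
   on the left. *)
Definition holo_form1 (w : cfield 'cV[C]_n) : Prop :=
  [/\ forall i z, ~ cimg i z -> w i z = 0,
      forall i z, cimg i z -> differentiable (w i) z &
      forall i j z, overlap i j z ->
        w i z = 'J (ctrans i j) z *m w j (ctrans i j z)].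

(* The value of a 2-form [B] on tangent vectors [u], [v] is
   [u *m B *m v^T]. *)
Definition holo_form2 (B : cfield 'M[C]_n) : Prop :=
  [/\ forall i z, (B i z)^T = - B i z,
      forall i z, ~ cimg i z -> B i z = 0,
      forall i z, cimg i z -> differentiable (B i) z &
      forall i j z, overlap i j z ->
        B i z = 'J (ctrans i j) z *m B j (ctrans i j z)
                  *m ('J (ctrans i j) z)^T].

Definition wedge (v w : cfield 'cV[C]_n) : cfield 'M[C]_n :=
  fun i z => v i z *m (w i z)^T - w i z *m (v i z)^T.

Definition lincomb (M : lmodType C) (d : nat) (b : 'I_d -> cfield M)
    (c : 'rV[C]_d) : cfield M :=
  fun i z => \sum_(j < d) c 0 j *: b j i z.

Definition is_basis (M : lmodType C) (P : set (cfield M)) (d : nat)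
    (b : 'I_d -> cfield M) : Prop :=
  (forall j, P (b j)) /\ (forall e, P e -> exists! c, e = lincomb b c).

Definition coords (M : lmodType C) (d : nat) (b : 'I_d -> cfield M)
    (e : cfield M) : 'rV[C]_d :=
  xget 0 [set c | e = lincomb b c].

(** ** Kaehler metrics *)

Definition rquot (f : 'rV[C]_n -> C) (v z : 'rV[C]_n) : R -> C :=
  fun t => (t%:C%C : C)^-1 * (f (z + (t%:C%C : C) *: v) - f z).

Definition rderive (f : 'rV[C]_n -> C) (v : 'rV[C]_n) : 'rV[C]_n -> C :=
  fun z => lim (rquot f v z t @[t --> (0 : R)^']).

(* [C^m] in the real sense, for [A] open *)
Fixpoint rsmooth_upto (m : nat) (A : set 'rV[C]_n) (f : 'rV[C]_n -> C)
    : Prop :=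
  (forall z, A z -> {for z, continuous f}) /\
  (if m is m'.+1 then forall v : 'rV[C]_n,
      (forall z, A z -> cvg (rquot f v z t @[t --> (0 : R)^'])) /\
      rsmooth_upto m' A (rderive f v)
   else True).

Definition rsmooth (A : set 'rV[C]_n) (f : 'rV[C]_n -> C) : Prop :=
  forall m, rsmooth_upto m A f.

(* The Wirtinger derivative d/dz_a *)
Definition dz (a : 'I_n) (f : 'rV[C]_n -> C) (z : 'rV[C]_n) : C :=
  2^-1 * (rderive f (delta_mx 0 a) z
          - 'i * rderive f ('i *: delta_mx 0 a) z).

Definition conj_entries (m p : nat) (A : 'M[C]_(m, p)) : 'M[C]_(m, p) :=
  map_mx Num.conj A.

(* [u *m H *m (conj_entries v)^T] is a hermitian metric; its fundamental form is
   [i/2 sum_ab H_ab dz_a /\ d(conj z_b)].  Since [H] is hermitian, that form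
   is closed iff its image under [sum_c dz_c /\ d/dz_c] vanishes, which is
   the last condition. *)
Definition kaehler_metric (H : cfield 'M[C]_n) : Prop :=
  [/\ forall i z, cimg i z -> conj_entries (H i z)^T = H i z,
      forall i z, cimg i z -> forall u : 'rV[C]_n, u != 0 ->
        0 < (u *m H i z *m (conj_entries u)^T) 0 0,
      forall i j z, overlap i j z ->
        H i z = 'J (ctrans i j) z *m H j (ctrans i j z)
                  *m (conj_entries ('J (ctrans i j) z))^T,
      forall i a b, rsmooth (cimg i) (fun z => H i z a b) &
      forall i z, cimg i z -> forall a b c,
        dz c (fun y => H i y a b) z = dz a (fun y => H i y c b) z].

Definition compact_kaehler : Prop :=
  compact [set: X] /\ exists H, kaehler_metric H.

End Manifold.

(** * Grassmannians *)

Definition Gr (R : realType) (k q : nat) :=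
  {W : {vspace 'rV[CC R]_q} | \dim W == k}.

Definition subsp (R : realType) (k q : nat) (W : Gr R k q)
  : {vspace 'rV[CC R]_q} := sval W.

Section GrassmannianTopology.
Context (R : realType) (k q : nat).
Local Notation C := (CC R).

(* The quotient topology for the map sending a [k * q] matrix of rank [k]
   to its row space; [subsp W = rowspan A] forces [A] to have rank [k]. *)
Definition rowspan (A : 'M[C]_(k, q)) : {vspace 'rV[C]_q} :=
  <<[seq row i A | i : 'I_k]>>%VS.

Definition Gr_open : set (set (Gr R k q)) :=
  [set U | exists2 O : set 'M[C]_(k, q), open O &
    forall A (W : Gr R k q), subsp W = rowspan A -> (O A <-> U W)].

Lemma Gr_openT : Gr_open setT.
Proof. by exists setT; [exact: openT|]. Qed.

Lemma Gr_openI : setI_closed Gr_open.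
Proof.
move=> U V [Q Qo QU] [P Po PV]; exists (Q `&` P) => [|A W AW].
  exact: openI.
by split=> -[/(QU _ _ AW) ? /(PV _ _ AW)].
Qed.

Lemma Gr_open_bigU (I : Type) (f : I -> set (Gr R k q)) :
  (forall i, Gr_open (f i)) -> Gr_open (\bigcup_i f i).
Proof.
move=> fo; have /choice[Q QP] : forall i, exists O : set 'M[C]_(k, q),
    open O /\ forall A W, subsp W = rowspan A -> (O A <-> f i W).
  by move=> i; have [Q Qo Qi] := fo i; exists Q.
exists (\bigcup_i Q i) => [|A W AW].
  by apply: bigcup_open => i _; have [] := QP i.
by split=> -[i _ Qi]; exists i => //; apply/(proj2 (QP i) _ _ AW).
Qed.

HB.instance Definition _ := Choice.on (Gr R k q).
HB.instance Definition _ := isOpenTopological.Build (Gr R k q)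
  Gr_openT Gr_openI Gr_open_bigU.

End GrassmannianTopology.

(** * Singular cohomology *)

Definition simplex (R : realType) (m : nat) : set 'rV[R]_m.+1 :=
  [set t | (forall i, 0 <= t 0 i) /\ \sum_i t 0 i = 1].
Arguments simplex R m : clear implicits.

Section Cohomology.
Context {R : realType}.

(* The affine map between standard simplices given by a map of vertices. *)
Definition vertex_sum (m p : nat) (th : 'I_m.+1 -> 'I_p.+1) (t : 'rV[R]_m.+1)
    : 'rV[R]_p.+1 := \row_j \sum_(i | th i == j) t 0 i.

Lemma vertex_sum_simplex m p th (t : simplex R m) :
  vertex_sum th (set_val t) \in simplex R p.
Proof.
have [t0 t1] : simplex R m (set_val t) by exact: set_valP.
apply/mem_set; split=> [j|]; first by rewrite mxE sumr_ge0.
rewrite -t1 (partition_big th predT) //=.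
by apply: eq_bigr => j _; rewrite mxE.
Qed.

Definition affine (m p : nat) (th : 'I_m.+1 -> 'I_p.+1) (t : simplex R m)
  : simplex R p := SigSub (vertex_sum_simplex th t).

Section Cochains.
Context {T : topologicalType}.

(* An integral cochain is a family of functions, one for each degree, on
   singular simplices; its values on discontinuous maps are irrelevant.
   Components of all degrees are kept together, so that a cohomology class
   modulo [cohomologous] is an element of the product of all H^m. *)
Definition cochain := forall m, (simplex R m -> T) -> int.

Definition singular (A : set T) (m : nat) (s : simplex R m -> T) : Prop :=
  continuous s /\ forall t, A (s t).

Definition coboundary (f : cochain) : cochain := fun m =>
  match m with
  | 0 => fun _ => 0
  | m'.+1 => fun s =>
      \sum_(j < m'.+2) (-1) ^+ j * f m' (s \o affine (lift j))
  end.

Definition cocycle (A : set T) (f : cochain) : Prop :=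
  forall m s, singular A s -> coboundary f (m := m) s = 0.

Definition homogeneous (d : nat) (f : cochain) : Prop :=
  forall m s, m != d -> f m s = 0.

Definition cohomologous (A : set T) (f g : cochain) : Prop :=
  exists b : cochain, forall m s,
    singular A s -> f m s - g m s = coboundary b (m := m) s.

Definition cochain0 : cochain := fun _ _ => 0.
Definition cochain1 : cochain := fun m _ => (m == 0)%:R.

Definition cup (f g : cochain) : cochain := fun m s =>
  \sum_(a < m.+1)
     f a (s \o affine (fun x : 'I_a.+1 => inord x : 'I_m.+1))
   * g (m - a)%N
       (s \o affine (fun x : 'I_(m - a).+1 => inord (a + x) : 'I_m.+1)).

Definition cup_pow (f : cochain) (e : nat) : cochain :=
  iter e (cup f) cochain1.

Definition cochain_lincomb (I : finType) (P : pred I) (a : I -> int)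
    (f : I -> cochain) : cochain :=
  fun m s => \sum_(i | P i) a i * f i m s.

(* The cohomology class of a closed irreducible subvariety [Z] of complex
   codimension [d]: the generator of the kernel of restriction
   H^2d(T) -> H^2d(T - Z), i.e. the image of the generator of
   H^2d(T, T - Z) = Z.  This determines the class up to sign. *)
Definition cycle_class (Z : set T) (d : nat) (f : cochain) : Prop :=
  let in_kernel (g : cochain) :=
    [/\ homogeneous d.*2 g, cocycle setT g & cohomologous (~` Z) g cochain0] in
  in_kernel f /\ forall g, in_kernel g ->
    exists e : int, cohomologous setT g (fun m s => e * f m s).

End Cochains.

Definition pullback (S T : topologicalType) (g : S -> T)
    (f : cochain (T := T)) : cochain (T := S) :=
  fun m s => f m (g \o s).

End Cohomology.

Arguments cochain R T : clear implicits.

(** * Chern classes of a quotient of a trivial bundle *)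

Section Chern.
Context {R : realType} {T : topologicalType} {h : nat}.
Local Notation C := (CC R).

Definition hyperplane (u : 'rV[C]_h) : set (Gr R 1 h) :=
  [set L | forall xi, xi \in subsp L -> xi *m u^T = 0].

(* For [E] the quotient of the trivial bundle C^h by a subbundle [N], the
   dual of [E] is the annihilator of [N] in the dual of C^h, and this is the
   bundle of lines in it. *)
Definition proj_dual (N : T -> {vspace 'rV[C]_h}) : set (T * Gr R 1 h) :=
  [set x | forall xi u, xi \in subsp x.2 -> u \in N x.1 -> xi *m u^T = 0].

(* Grothendieck's definition, applied to the dual E' of E = C^h / N, of rank
   [r].  The tautological line bundle on P(E') has as dual O(1) the pull-back
   of O(1) on P(C^h'), whose first Chern class is the hyperplane class
   [zeta], and
     sum_i c_i(E') zeta^(r - i) = 0   with   c_i(E') = (-1)^i c_i(E).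
   As [zeta] is determined up to sign, [c_i] is determined up to (-1)^i. *)
Definition total_chern_class (N : T -> {vspace 'rV[C]_h})
    (c : cochain R T) : Prop :=
  exists (r : nat) (ci : nat -> cochain R T) (u : 'rV[C]_h)
         (zeta : cochain R (Gr R 1 h)),
  [/\ forall x, (\dim (N x) + r)%N = h,
      (0 < h)%N -> u != 0,
      cycle_class (hyperplane u) 1 zeta,
      (forall i, homogeneous i.*2 (ci i) /\ cocycle setT (ci i)) /\
        cohomologous setT (ci 0) cochain1 &
      cohomologous (proj_dual N)
        (fun m s => \sum_(i < r.+1) (-1) ^+ i *
           cup (pullback fst (ci i)) (cup_pow (pullback snd zeta) (r - i)) s)
        cochain0
      /\ cohomologous setT c (fun m s => \sum_(i < r.+1) ci i m s)].

End Chern.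

(** * The complex over the Grassmannian *)

(* Tensors of C^q (x) C^q are [q * q] matrices, [u (x) v] being
   [u^T *m v]. *)
Definition tensor (R : realType) (q : nat) (U V : {vspace 'rV[CC R]_q})
    : {vspace 'M[CC R]_q} :=
  <<[seq u^T *m v | u <- vbasis U, v <- vbasis V]>>%VS.

Section DerivativeComplex.
Context {R : realType} {n : nat} {X : cmanifold R n} {q h : nat}.
Local Notation C := (CC R).
(* Bases of H^0(Omega^1) and H^0(Omega^2), identifying them with C^q
   and C^h *)
Variables (alpha : 'I_q -> cfield X 'cV[C]_n).
Variables (beta : 'I_h -> cfield X 'M[C]_n).

Definition wedge_map : 'Hom('M[C]_q, 'rV[C]_h) :=
  linfun (fun t : 'M[C]_q => \sum_i \sum_j
            t i j *: coords beta (wedge (alpha i) (alpha j))).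

Definition sym_map : 'End('M[C]_q) := linfun (fun t : 'M[C]_q => t + t^T).
Definition skew_map : 'End('M[C]_q) := linfun (fun t : 'M[C]_q => t - t^T).

(* Sym^2 W is W (x) W modulo the span of the w1 (x) w2 - w2 (x) w1, which is
   the image of W (x) W by [skew_map]; [sym_map] induces the first map of
   the complex.  The two equations are exactness at Sym^2 W and at W (x) V. *)
Definition exact_at (W : {vspace 'rV[C]_q}) : Prop :=
  (lker sym_map :&: tensor W W = skew_map @: tensor W W)%VS /\
  (lker wedge_map :&: tensor W fullv = sym_map @: tensor W W)%VS.

(* The fibre of F at W is C^h modulo this subspace. *)
Definition image_at (W : {vspace 'rV[C]_q}) : {vspace 'rV[C]_h} :=
  (wedge_map @: tensor W fullv)%VS.

End DerivativeComplex.

(** * Schubert cycles *)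

(* Parts are indexed from 0, so that [l i] is lambda_(i+1). *)
Definition is_part (k m : nat) (l : {ffun 'I_k -> 'I_m.+1}) : bool :=
  [forall i : 'I_k, forall j : 'I_k, (i <= j)%N ==> (l j <= l i)%N].

Definition part_size (k m : nat) (l : {ffun 'I_k -> 'I_m.+1}) : nat :=
  (\sum_i l i)%N.

Definition part_bigger (k m : nat) (l l' : {ffun 'I_k -> 'I_m.+1}) : bool :=
  [forall i, (l' i <= l i)%N] && [exists i, (l' i < l i)%N].

Definition mu (k q : nat) : {ffun 'I_k -> 'I_(q - k).+1} :=
  [ffun i : 'I_k => inord (q - k - i.+1)].

Definition schubert (R : realType) (k q : nat) (v : q.-tuple 'rV[CC R]_q)
    (l : {ffun 'I_k -> 'I_(q - k).+1}) : set (Gr R k q) :=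
  [set W | forall i : 'I_k,
     (i.+1 <= \dim (subsp W :&: <<take (q - k + i.+1 - l i) v>>))%N].

(* Main.v *)
Require Import Defs.
From HB Require Import structures.
From mathcomp Require Import all_boot all_order all_algebra complex.
From mathcomp Require Import all_classical all_reals all_analysis.
From mathcomp Require Import perm ring zify.
Set Implicit Arguments.
Unset Strict Implicit.
Unset Printing Implicit Defensive.
Import Order.TTheory GRing.Theory Num.Theory numFieldNormedType.Exports.
Local Open Scope classical_set_scope.
Local Open Scope ring_scope.

(* The exactness condition bounds the kernel of the wedge map.  If a skew
   tensor t of rank at most 2k is killed by the wedge map, write it as s - s^T
   with s in W (x) V and dim W = k; the wedge map kills s, so exactness over W
   makes s symmetric and t = 0.  Hence the kernel of the wedge map on skew
   tensors meets the cone Y of skew matrices of rank at most 2k only in 0, and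
   h^{2,0} is at least dim Y, which is the claimed number: the entries (i, j)
   of a matrix in Y with i < j and i < 2k are algebraically independent.

   That h linear forms with h < dim Y have a common nonzero zero on Y is shown
   by counting: otherwise the Nullstellensatz makes every coordinate integral
   over these forms, and functions of degree at most D on Y span a space of
   dimension O(D^h), too small to separate the points of a grid. *)

(** * Polynomial functions and the Nullstellensatz *)

Section Spanned.
Context (C : fieldType) (T : Type) (Y : set T).

(** Functions are compared on [Y] only, so this concerns the space of restrictions to [Y] without
    forming a quotient ring. *)
Definition spanned (K : finType) (b : K -> T -> C) (f : T -> C) : Prop :=
  exists c : K -> C, forall y, Y y -> f y = \sum_k c k * b k y.

Lemma spanned_basis (K : finType) (b : K -> T -> C) k : spanned b (b k).
Proof.
exists (fun l => (l == k)%:R) => y _.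
rewrite (bigD1 k) //= eqxx mul1r big1 ?addr0 // => l /negPf ->.
by rewrite mul0r.
Qed.

Lemma spannedZ (K : finType) (b : K -> T -> C) f a :
  spanned b f -> spanned b (fun y => a * f y).
Proof.
move=> [c fc]; exists (fun k => a * c k) => y Yy.
by rewrite fc // mulr_sumr; apply: eq_bigr => k _; rewrite mulrA.
Qed.

Lemma spanned_sum (K : finType) (b : K -> T -> C) (J : eqType) (s : seq J)
    (f : J -> T -> C) :
  (forall j, j \in s -> spanned b (f j)) ->
  spanned b (fun y => \sum_(j <- s) f j y).
Proof.
elim: s => [|j s IH] sf.
  exists (fun=> 0) => y _.
  by rewrite big_nil big1 // => k _; rewrite mul0r.
have [c fc] := sf _ (mem_head _ _).
have [|c' fc'] := IH; first by move=> i si; apply: sf; rewrite inE si orbT.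
exists (fun k => c k + c' k) => y Yy.
rewrite big_cons fc // fc' // -big_split; apply: eq_bigr => k _.
by rewrite mulrDl.
Qed.

Lemma spanned_eq (K : finType) (b : K -> T -> C) f g :
  (forall y, Y y -> f y = g y) -> spanned b f -> spanned b g.
Proof. by move=> fg [c fc]; exists c => y Yy; rewrite -fg ?fc. Qed.

(** The matrix of coefficients has more rows than columns, and a nonzero vector of its left kernel
    is the relation. *)
Lemma spanned_dependent (K J : finType) (b : K -> T -> C) (f : J -> T -> C) :
  (forall j, spanned b (f j)) -> (#|K| < #|J|)%N ->
  exists2 c : J -> C, exists j, c j != 0 &
    forall y, Y y -> \sum_j c j * f j y = 0.
Proof.
move=> /choice[a fa] KJ.
pose A := \matrix_(j < #|J|, k < #|K|) a (enum_val j) (enum_val k).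
have kA : kermx A != 0.
  rewrite -mxrank_eq0 mxrank_ker subn_eq0 -ltnNge.
  exact: leq_ltn_trans (rank_leq_col A) KJ.
pose v := nz_row (kermx A).
have vA : v *m A = 0 by apply/eqP; rewrite -sub_kermx nz_row_sub.
have /rV0Pn[j vj] : v != 0 by rewrite nz_row_eq0.
exists (fun j => v 0 (enum_rank j)); first by exists (enum_val j);
  rewrite enum_valK.
move=> y Yy; under eq_bigr => i _ do rewrite fa // mulr_sumr.
rewrite exchange_big big1 //= => k _.
have := congr1 (fun B : 'rV_#|K| => B 0 (enum_rank k)) vA; rewrite !mxE => vAk.
rewrite -[RHS](mul0r (b k y)) -[in RHS]vAk mulr_suml.
rewrite (reindex_onto enum_val enum_rank) /=; last by move=> i _; rewrite enum_rankK.
rewrite (eq_bigl predT) => [|i]; last by rewrite enum_valK eqxx.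
by apply: eq_bigr => i _; rewrite enum_valK !mxE enum_rankK mulrA.
Qed.

End Spanned.

Section PolynomialFunctions.
Context (C : fieldType) (I : finType).
Local Notation T := (I -> C).

(** Polynomials are treated as functions. The index is an upper bound for the degree, and
    multiplication by one variable at a time makes properties provable by a Horner-like
    induction. *)
Inductive polyfun : nat -> (T -> C) -> Prop :=
| polyfun_cst d a : polyfun d (fun=> a)
| polyfun_varM d i f : polyfun d f -> polyfun d.+1 (fun y => y i * f y)
| polyfun_add d f g :
    polyfun d f -> polyfun d g -> polyfun d (fun y => f y + g y).

Lemma polyfun_eq d f g : f =1 g -> polyfun d f -> polyfun d g.
Proof. by move=> /funext ->. Qed.

Lemma polyfun_leq d e f : (d <= e)%N -> polyfun d f -> polyfun e f.
Proof.
move=> + pf; elim: pf e => {d f} [d a|d i f _ IH [//|e]|d f g _ IHf _ IHg] *.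
- exact: polyfun_cst.
- by apply: polyfun_varM; apply: IH.
- by apply: polyfun_add; [apply: IHf|apply: IHg].
Qed.

Lemma polyfun_mul d e f g :
  polyfun d f -> polyfun e g -> polyfun (d + e) (fun y => f y * g y).
Proof.
move=> pf pg; elim: pf => {d f} [d a|d i f _ IH|d f1 f2 _ IH1 _ IH2].
- apply: (polyfun_leq (leq_addl d e)).
  elim: pg => {e g} [e b|e i g _ IH|e g1 g2 _ IH1 _ IH2].
  + exact: polyfun_cst.
  + apply: (polyfun_eq _ (polyfun_varM i IH)) => y.
    by rewrite mulrCA.
  + apply: (polyfun_eq _ (polyfun_add IH1 IH2)) => y.
    by rewrite mulrDr.
- by apply: (polyfun_eq _ (polyfun_varM i IH)) => y; rewrite mulrA.
- by apply: (polyfun_eq _ (polyfun_add IH1 IH2)) => y; rewrite mulrDl.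
Qed.

Lemma polyfun_var i : polyfun 1 (fun y => y i).
Proof.
by apply: (polyfun_eq _ (polyfun_varM i (polyfun_cst 0 1))) => y; rewrite mulr1.
Qed.

Lemma polyfunZ d a f : polyfun d f -> polyfun d (fun y => a * f y).
Proof. by move=> pf; apply: (polyfun_mul (polyfun_cst 0 a) pf). Qed.

Lemma polyfun_sum (J : Type) (s : seq J) d (f : J -> T -> C) :
  (forall j, polyfun d (f j)) -> polyfun d (fun y => \sum_(j <- s) f j y).
Proof.
move=> pf; elim: s => [|j s IH].
  by apply: (polyfun_eq _ (polyfun_cst d 0)) => y; rewrite big_nil.
by apply: (polyfun_eq _ (polyfun_add (pf j) IH)) => y; rewrite big_cons.
Qed.

Lemma polyfun_prod (J : Type) (s : seq J) (P : pred J) (d : J -> nat)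
    (f : J -> T -> C) : (forall j, polyfun (d j) (f j)) ->
  polyfun (\sum_(j <- s | P j) d j) (fun y => \prod_(j <- s | P j) f j y).
Proof.
move=> pf; elim: s => [|j s IH].
  rewrite big_nil.
  by apply: (polyfun_eq _ (polyfun_cst 0 1)) => y; rewrite big_nil.
rewrite big_cons; case Pj: (P j).
  by apply: (polyfun_eq _ (polyfun_mul (pf j) IH)) => y; rewrite big_cons Pj.
by apply: (polyfun_eq _ IH) => y; rewrite big_cons Pj.
Qed.

Lemma polyfun_exp d f e :
  polyfun d f -> polyfun (e * d) (fun y => f y ^+ e).
Proof.
move=> pf; elim: e => [|e IH]; first exact: (polyfun_cst 0 1).
rewrite mulSn.
by apply: (polyfun_eq _ (polyfun_mul pf IH)) => y; rewrite exprS.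
Qed.

Lemma polyfun_horner i (p : {poly C}) :
  exists d, polyfun d (fun y => p.[y i]).
Proof.
elim/poly_ind: p => [|p a [d pd]].
  by exists 0; apply: (polyfun_eq _ (polyfun_cst 0 0)) => y; rewrite horner0.
exists d.+1.
apply: (polyfun_eq _ (polyfun_add (polyfun_varM i pd) (polyfun_cst d.+1 a))).
by move=> y; rewrite hornerMXaddC mulrC.
Qed.

Definition monom (m : {ffun I -> nat}) (y : T) : C := \prod_i y i ^+ m i.

Lemma polyfun_monom (m : {ffun I -> nat}) : polyfun (\sum_i m i) (monom m).
Proof.
rewrite /monom; apply: polyfun_prod => i.
by rewrite -[X in polyfun X]muln1; apply/polyfun_exp/polyfun_var.
Qed.

Lemma polyfun_monomP d f : polyfun d f ->
  exists2 s : seq (C * {ffun I -> nat}),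
    forall p, p \in s -> (\sum_i p.2 i <= d)%N &
    forall y, f y = \sum_(p <- s) p.1 * monom p.2 y.
Proof.
elim=> {d f} [d a|d i f _ [s sd sf]|d f g _ [s sd sf] _ [t td tg]].
- exists [:: (a, [ffun=> 0])] => [p|y].
    rewrite inE => /eqP ->; rewrite big1 // => i _.
    by rewrite ffunE.
  rewrite big_seq1 /monom big1 ?mulr1 // => i _.
  by rewrite ffunE expr0.
- pose up (p : C * {ffun I -> nat}) := (p.1, [ffun j => ((j == i) + p.2 j)%N]).
  exists (map up s) => [p /mapP[p' sp' ->] /=|y].
    under eq_bigr => j _ do rewrite ffunE.
    rewrite big_split -add1n leq_add ?sd //=.
    by rewrite (bigD1 i) //= eqxx big1 // => j /negPf ->.
  rewrite sf mulr_sumr big_map; apply: eq_bigr => p _ /=.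
  rewrite mulrCA; congr (_ * _); rewrite /monom.
  under [in RHS]eq_bigr => j _ do rewrite ffunE exprD.
  rewrite big_split /= [X in _ = X * _](bigD1 i) //= eqxx expr1.
  by rewrite [X in _ * X * _]big1 ?mulr1 // => j /negPf ->.
- exists (s ++ t) => [p|y]; last by rewrite big_cat /= sf tg.
  by rewrite mem_cat => /orP[/sd|/td].
Qed.

(** In degree at most [d] every exponent is at most [d], so the finitely many monomials with
    exponents in ['I_d.+1] span. *)
Lemma polyfun_spanned d : exists (K : finType) (b : K -> T -> C),
  forall f, polyfun d f -> spanned setT b f.
Proof.
pose b (k : {ffun I -> 'I_d.+1}) : T -> C := monom [ffun i => k i : nat].
exists {ffun I -> 'I_d.+1}, b => f.
move=> /polyfun_monomP[s sd sf].
apply: (spanned_eq (fun y _ => esym (sf y))).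
apply: spanned_sum => -[a m] /sd /= md; apply: spannedZ.
have -> : m = [ffun i => [ffun i => inord (m i) : 'I_d.+1] i : nat].
  apply/ffunP => i; rewrite !ffunE inordK // ltnS.
  by apply: leq_trans md; rewrite (bigD1 i) //= leq_addr.
exact: spanned_basis.
Qed.

End PolynomialFunctions.

(** * Zeros of proper ideals over an uncountable algebraically closed field *)

Section Nullstellensatz.
Context (C : closedFieldType) (I : finType).
Local Notation T := (I -> C).
Hypothesis C_uncountable : ~ countable [set: C].

(** A module over the polynomial functions inside all functions: members may be non-polynomial, but
    multipliers are polynomial. *)
Definition ideal (J : set (T -> C)) : Prop :=
  [/\ J (fun=> 0), forall f g, J f -> J g -> J (fun y => f y + g y) &
      forall d a f, polyfun d a -> J f -> J (fun y => a y * f y)].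

Lemma ideal_eq (J : set (T -> C)) f g : f =1 g -> J f -> J g.
Proof. by move=> /funext ->. Qed.

Lemma ideal_sum J (K : Type) (s : seq K) (f : K -> T -> C) :
  ideal J -> (forall k, J (f k)) -> J (fun y => \sum_(k <- s) f k y).
Proof.
move=> [J0 JD _] Jf; elim: s => [|k s IH].
  by apply: ideal_eq J0 => y; rewrite big_nil.
by apply: ideal_eq (JD _ _ (Jf k) IH) => y; rewrite big_cons.
Qed.

Definition ideal_adjoin (J : set (T -> C)) (g : T -> C) : set (T -> C) :=
  [set f | exists d a j, [/\ polyfun d a, J j & forall y, f y = j y + a y * g y]].

Lemma ideal_adjoin_sub J g : J `<=` ideal_adjoin J g.
Proof.
move=> f Jf; exists 0, (fun=> 0), f; split=> //; first exact: polyfun_cst.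
by move=> y; rewrite mul0r addr0.
Qed.

Lemma ideal_adjoin_self J g : ideal J -> ideal_adjoin J g g.
Proof.
move=> [J0 _ _]; exists 0, (fun=> 1), (fun=> 0); split=> //.
  exact: polyfun_cst.
by move=> y; rewrite mul1r add0r.
Qed.

Lemma ideal_adjoinP J g : ideal J -> ideal (ideal_adjoin J g).
Proof.
move=> JI; have [J0 JD JM] := JI; split.
- exact: ideal_adjoin_sub.
- move=> f1 f2 [d1 [a1 [j1 [p1 J1 f1E]]]] [d2 [a2 [j2 [p2 J2 f2E]]]].
  exists (maxn d1 d2), (fun y => a1 y + a2 y), (fun y => j1 y + j2 y).
  split; [|exact: JD|by move=> y; rewrite f1E f2E mulrDl addrACA].
  by apply: polyfun_add; [apply: polyfun_leq p1|apply: polyfun_leq p2];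
    rewrite ?leq_maxl ?leq_maxr.
- move=> d a f pa [d1 [a1 [j1 [p1 J1 f1E]]]].
  exists (d + d1)%N, (fun y => a y * a1 y), (fun y => a y * j1 y).
  split; [exact: polyfun_mul|exact: JM pa J1|].
  by move=> y; rewrite f1E mulrDr mulrA.
Qed.

(** Otherwise [C] would be a countable union of finite sets. With [h] a degree bound of a chosen
    inverse, this gives infinitely many inverses of bounded degree. *)
Lemma uncountable_fiber (h : C -> nat) :
  exists d, infinite_set [set c | h c = d].
Proof.
apply/existsNP => hfin; apply: C_uncountable.
have -> : [set: C] = \bigcup_(d in setT) [set c | h c = d].
  by apply/seteqP; split=> // c _; exists (h c).
by apply: bigcup_countable => // d _; apply: finite_set_countable.
Qed.

(* If every [y i - c] had an inverse [a_c] modulo [J], infinitely many of the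
   [a_c] would lie in one finite-dimensional space; clearing denominators in a
   linear relation between them gives a nonzero polynomial in [y i] in [J],
   hence, after splitting it, a product of units. *)
Lemma proper_adjoin J i : ideal J -> ~ J (fun=> 1) ->
  exists c, ~ ideal_adjoin J (fun y => y i - c) (fun=> 1).
Proof.
move=> JI J1; apply/not_existsP => H.
have [J0 JD JM] := JI.
have {}H c : exists x : nat * (T -> C) * (T -> C),
    [/\ polyfun x.1.1 x.1.2, J x.2 &
        forall y, 1 = x.2 y + x.1.2 y * (y i - c)].
  by have /contrapT[d [a [j [? ? ?]]]] := H c; exists ((d, a), j).
have {H}[x xP] := choice H.
have [d dinf] := uncountable_fiber (fun c => (x c).1.1).
have [K [b bP]] := @polyfun_spanned C I d.
(* One point more than the size of the spanning family forces a relation. *)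
have [S Sd KS] := infinite_set_fset #|K|.+1 dinf.
pose s := finmap.enum_fset S; have us : uniq s by exact: finmap.fset_uniq.
pose pt (j : 'I_(size s)) := s`_j.
have ptd j : (x (pt j)).1.1 = d.
  by apply: (Sd (pt j)); apply: (@mem_nth _ 0 s).
have pt_inj : injective pt.
  by move=> j j' /eqP; rewrite nth_uniq // => /eqP /val_inj.
have [j||l [j0 lj0] lP] := @spanned_dependent _ _ setT K _ b
  (fun j => (x (pt j)).1.2).
- by apply: bP; rewrite -(ptd j); have [] := xP (pt j).
- by rewrite card_ord.
(* [p] is the numerator of the sum of the fractions [l j / ('X - pt j)]; at [pt j0] only the term of
   [j0] survives, so [p] is nonzero. *)
pose Q j : {poly C} := \prod_(j' | j' != j) ('X - (pt j')%:P).
pose p := \sum_j l j *: Q j.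
have p0 : p != 0.
  apply/eqP => p0; move/negP: lj0; apply.
  have : p.[pt j0] = 0 by rewrite p0 horner0.
  rewrite /p horner_sum (bigD1 j0) //= [X in _ + X]big1 ?addr0.
    rewrite hornerZ => /eqP; rewrite mulf_eq0 => /orP[//|].
    rewrite horner_prod => /prodf_eq0[j jj0].
    by rewrite !hornerE subr_eq0 => /eqP /pt_inj j0j; rewrite j0j eqxx in jj0.
  move=> j jj0; rewrite hornerZ horner_prod (bigD1 j0) 1?eq_sym //=.
  by rewrite hornerXsubC subrr mul0r mulr0.
(* Expand each term of [p] by [1 = j + a * (y i - pt j)] with [j] in [J]: the parts containing the
   inverses add up to the relation [lP] times the common denominator, hence to 0. *)
have Jp : J (fun y => p.[y i]).
  have /(ideal_sum (index_enum _) JI) : forall j,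
      J (fun y => (l j *: Q j).[y i] * (x (pt j)).2 y).
    move=> j; have [e pe] := polyfun_horner i (l j *: Q j).
    by apply: (JM _ _ _ pe); have [] := xP (pt j).
  apply: ideal_eq => y.
  have := lP y Logic.I => /(congr1 (fun z => z * \prod_j (y i - pt j))).
  rewrite mul0r mulr_suml => lPy.
  rewrite -[LHS]addr0 -[X in _ + X]lPy -big_split /p horner_sum.
  apply: eq_bigr => j _ /=; rewrite (bigD1 j) //=.
  have -> : \prod_(j' | j' != j) (y i - pt j') = (Q j).[y i].
    by rewrite horner_prod; apply: eq_bigr => j' _; rewrite !hornerE.
  have [_ _ /(_ y) e1] := xP (pt j).
  rewrite -[RHS]mulr1 [in RHS]e1 hornerZ; ring.
(* Each [y i - c] is a unit modulo [J] and can be cancelled. Cancelling all linear factors of [p]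
   leaves its nonzero leading coefficient in [J]. *)
have unitM c f : J (fun y => f y * (y i - c)) -> (exists e, polyfun e f) ->
    J f.
  move=> Jf [e pe]; have [pa jJ e1] := xP c.
  apply: ideal_eq (JD _ _ (JM _ _ _ pe jJ) (JM _ _ _ pa Jf)) => y.
  by rewrite -[RHS]mulr1 [in RHS](e1 y); ring.
have [r pr] := closed_field_poly_normal p.
have lc0 : lead_coef p != 0 by rewrite lead_coef_eq0.
move: Jp; rewrite pr; elim: r {pr} => [|c r IH] Jp.
  apply: J1; apply: ideal_eq (JM 0 (fun=> (lead_coef p)^-1) _ _ Jp).
    by move=> y; rewrite big_nil -polyC1 hornerZ hornerC mulr1 mulVf.
  exact: polyfun_cst.
apply: IH; apply: (unitM c); last exact: polyfun_horner.
apply: ideal_eq Jp => y.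
by rewrite big_cons !hornerZ hornerM hornerXsubC; ring.
Qed.

(** Adjoining some [y i - z i] for one variable after another keeps the ideal proper. Modulo the
    final ideal every polynomial function equals its value at [z], so a member of [J] with nonzero
    value would put a unit there. *)
Theorem nullstellensatz J : ideal J -> ~ J (fun=> 1) ->
  exists z : T, forall d f, polyfun d f -> J f -> f z = 0.
Proof.
move=> JI J1.
have [J' [JI' J1' JJ' /choice[z zP]]] : exists J' : set (T -> C),
    [/\ ideal J', ~ J' (fun=> 1), J `<=` J' &
        forall i, exists c, J' (fun y => y i - c)].
  suff [J' [? ? ? H]] : exists J' : set (T -> C),
      [/\ ideal J', ~ J' (fun=> 1), J `<=` J' &
        forall i, i \in enum I -> exists c, J' (fun y => y i - c)].
    by exists J'; split=> // i; apply: H; rewrite mem_enum.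
  elim: (enum I) => [|i s [J' [JI' J1' JJ' H]]]; first by exists J; split=> // f.
  have [c cP] := proper_adjoin i JI' J1'.
  exists (ideal_adjoin J' (fun y => y i - c)); split=> //.
  - exact: ideal_adjoinP.
  - exact: (subset_trans JJ' (@ideal_adjoin_sub _ _)).
  - move=> i'; rewrite inE => /orP[/eqP ->|/H[c' ?]].
      by exists c; apply: ideal_adjoin_self.
    by exists c'; apply: ideal_adjoin_sub.
have [J0 JD JM] := JI'.
have Jz d f : polyfun d f -> J' (fun y => f y - f z).
  elim=> {d f} [d a|d i f pf IH|d f g _ IHf _ IHg].
  - by apply: ideal_eq J0 => y; rewrite subrr.
  - have pz := polyfun_cst I 0 (z i).
    apply: ideal_eq (JD _ _ (JM _ _ _ pf (zP i)) (JM _ _ _ pz IH)) => y.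
    by ring.
  - by apply: ideal_eq (JD _ _ IHf IHg) => y; ring.
exists z => d f pf Jf; apply/eqP/negP => /negP fz.
apply: J1'.
have J2 : J' (fun y => f y - (f y - f z)).
  have := JM _ _ _ (polyfun_cst I 0 (-1)) (Jz d f pf).
  move=> /(JD _ _ (JJ' _ Jf)); apply: ideal_eq => y; ring.
apply: ideal_eq (JM _ _ _ (polyfun_cst I 0 (f z)^-1) J2) => y.
by rewrite subKr mulVf.
Qed.

End Nullstellensatz.

(** * Linear sections of cones *)

Section ConeSection.
Context (C : closedFieldType) (I : finType).
Local Notation T := (I -> C).
Hypothesis C_uncountable : ~ countable [set: C].

(** The factor [y e ^+ d] clears the denominators of [f] evaluated at [y / y e]. *)
Lemma dehomogenize d (f : T -> C) (e : I) : polyfun d f ->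
  exists2 f' : T -> C, polyfun d f' &
    forall y, y e != 0 -> f' y = y e ^+ d * f (fun i => (y e)^-1 * y i).
Proof.
elim=> {d f} [d a|d i f _ [f' pf' f'E]|d f g _ [f' pf' f'E] _ [g' pg' g'E]].
- exists (fun y => a * y e ^+ d); last by move=> y _; rewrite mulrC.
  by apply: polyfunZ; rewrite -[X in polyfun X]muln1; apply/polyfun_exp/polyfun_var.
- exists (fun y => y i * f' y); first exact: polyfun_varM.
  by move=> y ye; rewrite f'E // exprS; field.
- exists (fun y => f' y + g' y); first exact: polyfun_add.
  by move=> y ye; rewrite f'E // g'E // mulrDr.
Qed.

Context (Y : set T) (h : nat) (l : 'I_h -> T -> C).
Hypothesis Y_cone : forall a y, Y y -> Y (fun i => a * y i).
Hypothesis l_poly : forall j, polyfun 1 (l j).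
Hypothesis l_homog : forall j a y, l j (fun i => a * y i) = a * l j y.

(** The ideal generated by the forms [l j], by [y e - 1] and by everything vanishing on [Y]. Its
    zeros are the points of the linear section of the closure of [Y] with [e]-th coordinate 1. *)
Let slice_ideal (e : I) : set (T -> C) := [set f | exists d a b,
  [/\ forall j, polyfun d (a j), polyfun d b &
      forall y, Y y -> f y = \sum_j a j y * l j y + b y * (y e - 1)]].

Let slice_ideal_ideal e : ideal (slice_ideal e).
Proof.
split.
- exists 0, (fun _ _ => 0), (fun=> 0); split=> [j||y _].
  + exact: polyfun_cst.
  + exact: polyfun_cst.
  + by rewrite big1 ?mul0r ?addr0 // => j _; rewrite mul0r.
- move=> f g [d [a [b [pa pb fE]]]] [d' [a' [b' [pa' pb' gE]]]].
  have pl (u : T -> C) : polyfun d u -> polyfun (maxn d d') u.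
    by apply: polyfun_leq; rewrite leq_maxl.
  have pr (u : T -> C) : polyfun d' u -> polyfun (maxn d d') u.
    by apply: polyfun_leq; rewrite leq_maxr.
  exists (maxn d d'), (fun j y => a j y + a' j y), (fun y => b y + b' y).
  split=> [j||y Yy]; [by apply: polyfun_add; auto..|].
  rewrite fE // gE // mulrDl addrACA -big_split; congr (_ + _).
  by apply: eq_bigr => j _; rewrite mulrDl.
- move=> d c f pc [d' [a [b [pa pb fE]]]].
  exists (d + d')%N, (fun j y => c y * a j y), (fun y => c y * b y).
  split=> [j||y Yy]; [exact: polyfun_mul..|].
  rewrite fE // mulrDr mulr_sumr mulrA; congr (_ + _).
  by apply: eq_bigr => j _; rewrite mulrA.
Qed.

Definition zariski_closure : set T :=
  [set z | forall d f, polyfun d f -> (forall y, Y y -> f y = 0) -> f z = 0].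

Let in_slice_ideal e d a b f : (forall j, polyfun d (a j)) -> polyfun d b ->
  (forall y, Y y -> f y = \sum_j a j y * l j y + b y * (y e - 1)) ->
  slice_ideal e f.
Proof. by move=> pa pb fE; exists d, a, b. Qed.

(** If [slice_ideal e] is proper, the Nullstellensatz gives the point. Otherwise 1 is a combination
    of the generators on [Y]; evaluating at [y / y e], which lies in the cone, kills [y e - 1], and
    clearing denominators gives the power. *)
Lemma cone_power_or_point (e : I) :
  (exists z, [/\ z e = 1, forall j, l j z = 0 & zariski_closure z]) \/
  (exists s a, (forall j, polyfun s (a j)) /\
     forall y, Y y -> y e ^+ s.+1 = \sum_j a j y * l j y).
Proof.
have JI := slice_ideal_ideal e.
have p0 d : polyfun d (fun=> 0 : C) by exact: polyfun_cst.
have [[d [a [b [pa _ E1]]]]|J1] := pselect (slice_ideal e (fun=> 1)); last first.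
  left; have [z zP] := nullstellensatz C_uncountable JI J1.
  exists z; split.
  - apply/eqP; rewrite -subr_eq0; apply/eqP.
    apply: (zP 1%N (fun y => y e - 1)).
      by apply: polyfun_add; [exact: polyfun_var|exact: polyfun_cst].
    apply: (@in_slice_ideal _ 0 (fun=> fun=> 0) (fun=> 1)) => // [|y _].
      exact: polyfun_cst.
    by rewrite big1 ?add0r ?mul1r // => j _; rewrite mul0r.
  - move=> j; apply: (zP _ _ (l_poly j)).
    apply: (@in_slice_ideal _ 0 (fun j' => fun=> (j' == j)%:R) (fun=> 0)) => //.
      by move=> j'; apply: polyfun_cst.
    move=> y _; rewrite mul0r addr0 (bigD1 j) //= eqxx mul1r big1 ?addr0 //.
    by move=> j' /negPf ->; rewrite mul0r.
  - move=> d f pf f0; apply: (zP _ _ pf).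
    apply: (@in_slice_ideal _ 0 (fun=> fun=> 0) (fun=> 0)) => // y Yy.
    by rewrite f0 // big1 ?mul0r ?addr0 // => j _; rewrite mul0r.
right.
have /choice[a' a'P] : forall j, exists a' : T -> C, polyfun d a' /\
    forall y, y e != 0 -> a' y = y e ^+ d * a j (fun i => (y e)^-1 * y i).
  by move=> j; have [a' ? ?] := dehomogenize e (pa j); exists a'.
(* [a' j] is controlled only where [y e] is nonzero; the additional factor [y e] makes both sides
   vanish elsewhere. *)
exists d.+1, (fun j y => y e * a' j y); split=> [j|y Yy].
  by apply: polyfun_varM; have [] := a'P j.
have [ye|ye] := eqVneq (y e) 0.
  by rewrite ye expr0n big1 // => j _; rewrite !mul0r.
have := E1 _ (Y_cone (y e)^-1 Yy); rewrite mulVf // subrr mulr0 addr0 => {}E1.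
rewrite -[LHS]mulr1 [in LHS]E1 mulr_sumr; apply: eq_bigr => j _.
have [_ ->] // := a'P j.
by rewrite l_homog !exprS; field.
Qed.

(* If the section were trivial, each coordinate would be integral on [Y] over
   the [l j], so functions of degree [D] on [Y] would span a space of dimension
   [O(D ^ h)], whereas a grid in [Y] separates [(d + 1) ^ #|K|] points by
   functions of degree [#|K| * d]. *)
Theorem cone_linear_section (K : finType) (eps : K -> I) :
  (forall d, exists2 v : K -> 'I_d.+1 -> C, (forall k, injective (v k)) &
    forall g : {ffun K -> 'I_d.+1}, exists2 y, Y y &
      forall k, y (eps k) = v k (g k)) ->
  (h < #|K|)%N ->
  exists z, [/\ exists i, z i != 0, forall j, l j z = 0 & zariski_closure z].
Proof.
move=> grid hK; apply: contrapT => noz.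
have powers e : exists sa : nat * ('I_h -> T -> C),
    (forall j, polyfun sa.1 (sa.2 j)) /\
    forall y, Y y -> y e ^+ sa.1.+1 = \sum_j sa.2 j y * l j y.
  have [[z [ze zl zc]]|[s [a ?]]] := cone_power_or_point e; last by exists (s, a).
  by case: noz; exists z; split=> //; exists e; rewrite ze oner_eq0.
have {powers}[S powers] : exists S, forall e, exists2 a : 'I_h -> T -> C,
    forall j, polyfun S (a j) &
    forall y, Y y -> y e ^+ S.+1 = \sum_j a j y * l j y.
  have [sa saP] := choice powers.
  (* Multiplying the relation of [e] by a power of [y e] gives all coordinates the same exponent. *)
  exists (\max_e (sa e).1) => e; have [pa ya] := saP e.
  set s := (sa e).1 in pa ya *; set S := \max__ _.
  have sS : (s <= S)%N by apply: (leq_bigmax (F := fun e => (sa e).1)).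
  exists (fun j y => y e ^+ (S - s) * (sa e).2 j y) => [j|y Yy].
    rewrite -(subnK sS); apply: polyfun_mul => //.
    by rewrite subnK // -[X in polyfun X]muln1; apply/polyfun_exp/polyfun_var.
  rewrite -(subnK sS) -addnS exprD ya // subnK // mulr_sumr.
  by apply: eq_bigr => j _; rewrite mulrA.
(* A family of [D.+1 ^ h * S.+1 ^ #|I|] functions: only the exponents of the [h] forms grow with
   [D]. *)
pose b D (x : {ffun 'I_h -> 'I_D.+1} * {ffun I -> 'I_S.+1}) (y : T) :=
  \prod_j l j y ^+ x.1 j * monom [ffun i => x.2 i : nat] y.
(* Strong induction on [d]. A factor [y e ^+ S.+1] of a monomial is replaced by a sum of [a j * l j]
   with [a j] of degree at most [S]: one [al j] grows by 1 while the polynomial factor loses at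
   least one degree, so [al j + d] stays bounded by [D]. *)
have red D d : forall f (al : 'I_h -> nat), polyfun d f ->
    (forall j, al j + d <= D)%N ->
    spanned Y (@b D) (fun y => \prod_j l j y ^+ al j * f y).
  have [n] := ubnP d; elim: n d => // n IH d dn f al pf alD.
  have [s sd sf] := polyfun_monomP pf.
  apply: (@spanned_eq _ _ Y _ _
    (fun y => \sum_(p <- s) p.1 * (\prod_j l j y ^+ al j * monom p.2 y))).
    by move=> y _; rewrite sf mulr_sumr; apply: eq_bigr => p _; rewrite mulrCA.
  apply: spanned_sum => -[c m] /sd /= md; apply: spannedZ.
  have [/forallP mS|/forallPn[e]] := boolP [forall i, (m i <= S)%N].
    pose x := ([ffun j => inord (al j)] : {ffun 'I_h -> 'I_D.+1},
      [ffun i => inord (m i)] : {ffun I -> 'I_S.+1}).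
    apply: (spanned_eq _ (spanned_basis Y (@b D) x)) => y _; rewrite /b /=.
    congr (_ * _).
      apply: eq_bigr => j _; rewrite ffunE inordK // ltnS.
      exact: leq_trans (leq_addr _ _) (alD j).
    by congr monom; apply/ffunP => i; rewrite !ffunE inordK ?ltnS.
  rewrite -ltnNge => Sm; have [a pa ya] := powers e.
  pose m' := [ffun i => (m i - (i == e) * S.+1)%N].
  have mE y : monom m y = y e ^+ S.+1 * monom m' y.
    rewrite /monom (bigD1 e) //= [in RHS](bigD1 e) //= mulrA -exprD.
    rewrite ffunE eqxx mul1n subnKC //; congr (_ * _); apply: eq_bigr => i ie.
    by rewrite ffunE (negPf ie) subn0.
  have m'd : (S + \sum_i m' i < d)%N.
    apply: leq_trans md; rewrite (bigD1 e) //= [in leqRHS](bigD1 e) //=.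
    rewrite ffunE eqxx mul1n addnA -addSn -addSn subnKC // leq_add2l.
    by apply/eq_leq/eq_bigr => i ie; rewrite ffunE (negPf ie) subn0.
  apply: (@spanned_eq _ _ Y _ _ (fun y => \sum_j
    (\prod_j' l j' y ^+ (al j' + (j' == j)) * (a j y * monom m' y)))).
    move=> y Yy; rewrite mE ya // mulr_suml mulr_sumr; apply: eq_bigr => j _.
    under eq_bigr => j' _ do rewrite exprD.
    rewrite big_split /= [X in _ * X * _](bigD1 j) //= eqxx expr1.
    by rewrite [X in _ * (_ * X) * _]big1 => [|j' /negPf ->] //; ring.
  apply: spanned_sum => j _.
  apply: (IH (S + \sum_i m' i)%N).
  - lia.
  - by apply: polyfun_mul; [exact: pa|exact: polyfun_monom].
  - move=> j'; apply: leq_trans (alD j'); rewrite -addnA leq_add2l.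
    by apply: leq_trans m'd; rewrite -add1n leq_add2r leq_b1.
set N := #|K| in hK.
pose G := (S.+1 ^ #|I|)%N.
(* This choice gives [(N * d).+1 ^ h * G <= d * d.+1 ^ h < d.+1 ^ h.+1 <= d.+1 ^ N], so there are
   more grid points than spanning functions. *)
pose d := (N ^ h * G)%N.
have [v v_inj vY] := grid d.
(* Lagrange interpolation: [L g] vanishes at every grid point except that of [g], and has degree at
   most [N * d]. *)
pose L (g : {ffun K -> 'I_d.+1}) (y : T) :=
  \prod_k \prod_(c | c != g k) (y (eps k) - v k c).
have Lspan g : spanned Y (@b (N * d)%N) (L g).
  have pL : polyfun (N * d) (L g).
    have -> : (N * d = \sum_(k : K) \sum_(c | c != g k) 1)%N.
      under eq_bigr => k _.
        rewrite sum1_card.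
        rewrite (_ : #|_| = d); first over.
        by have := cardC1 (g k); rewrite card_ord.
      by rewrite sum_nat_const.
    apply: polyfun_prod => k; apply: polyfun_prod => c.
    by apply: polyfun_add; [exact: polyfun_var|exact: polyfun_cst].
  apply: (spanned_eq _ (red _ _ _ (fun=> 0) pL _)) => [y _|j //].
  by rewrite big1 ?mul1r // => j _; rewrite expr0.
have [|c [g0 cg0] cP] := spanned_dependent Lspan.
  rewrite card_prod !card_ffun !card_ord -/G -/N.
  have N0 : (0 < N)%N by apply: leq_ltn_trans hK.
  apply: (@leq_ltn_trans ((N * d.+1) ^ h * G)%N).
    rewrite leq_mul2r; apply/orP; right.
    case: (h) => // h'; rewrite leq_exp2r //.
    by rewrite -addn1 mulnS addnC leq_add2r.
  rewrite expnMn mulnAC -/d -ltnS.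
  apply: (@leq_trans (d.+1 ^ h.+1).+1); last by rewrite ltnS leq_pexp2l.
  by rewrite ltnS expnS ltn_pmul2r ?expn_gt0.
have [y Yy yE] := vY g0.
have := cP y Yy; rewrite (bigD1 g0) //= [X in _ + X]big1 ?addr0.
  move=> /eqP; rewrite mulf_eq0 (negPf cg0) /= => /prodf_eq0[k _].
  move=> /prodf_eq0[i ig]; rewrite yE subr_eq0 => /eqP /v_inj gi.
  by rewrite gi eqxx in ig.
move=> g gg0; rewrite /L.
have [k gk] : exists k, g k != g0 k.
  by apply/existsP; apply: contraNT gg0 => /existsPn gg; apply/eqP/ffunP => k;
    apply/eqP; rewrite -[_ == _]negbK gg.
rewrite (bigD1 k) //= (bigD1 (g0 k)) 1?eq_sym //= yE subrr.
by rewrite !(mul0r, mulr0).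
Qed.

End ConeSection.

(** An injection into the natural numbers would make the real unit interval countable, hence of
    measure 0. *)
Lemma complex_uncountable (R : realType) : ~ countable [set: R[i]].
Proof.
move=> /countable_injP[f finj].
have : lebesgue_measure `[0%R : R, 1%R] = 0%E.
  apply: countable_lebesgue_measure0; apply/countable_injP.
  exists (fun x : R => f x%:C%C) => x y _ _ /finj.
  by rewrite !inE => /(_ Logic.I Logic.I) [].
by rewrite lebesgue_measure_itv /= lte_fin ltr01 oppr0 adde0 => /eqP;
  rewrite eqe oner_eq0.
Qed.

(** * Skew matrices of bounded rank *)

(** This detects the rank by a polynomial in the entries, so that rank bounds pass to the Zariski
    closure. *)
Lemma nonzero_minor (F : fieldType) m n (A : 'M[F]_(m, n)) :
  exists (f : 'I_(\rank A) -> 'I_m) (g : 'I_(\rank A) -> 'I_n),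
    \det (mxsub f g A) != 0.
Proof.
set B := rowsub (maxrankfun A) A.
have BT : row_full B^T by rewrite /row_full mxrank_tr -/(row_free B) maxrowsub_free.
exists (maxrankfun A), (fullrankfun BT).
have := fullrowsub_unit BT; rewrite unitmxE unitfE -det_tr.
by congr (\det _ != 0); apply/matrixP => i j; rewrite !mxE.
Qed.

Lemma mxrank_mxsub (F : fieldType) m n m' n' (f : 'I_m' -> 'I_m)
    (g : 'I_n' -> 'I_n) (A : 'M[F]_(m, n)) : (\rank (mxsub f g A) <= \rank A)%N.
Proof.
have -> : mxsub f g A = rowsub f 1%:M *m A *m colsub g 1%:M.
  rewrite mul_rowsub_mx mul1mx mulmx_colsub mulmx1.
  by apply/matrixP => i j; rewrite !mxE.
by rewrite (leq_trans (mxrankM_maxl _ _)) // mxrankM_maxr.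
Qed.

Section SkewMatrices.
Context (F : fieldType).
Hypothesis two_neq0 : (2 : F) != 0.

Lemma skew_diag0 n (t : 'M[F]_n) i : t^T = - t -> t i i = 0.
Proof.
move=> /matrixP/(_ i i); rewrite !mxE => /eqP; rewrite -addr_eq0 -mulr2n.
by rewrite -mulr_natl mulf_eq0 (negPf two_neq0) => /eqP.
Qed.

(** Darboux reduction: each nonzero entry splits off a skew matrix of rank 2 and lowers the rank by
    2. *)
Lemma skew_decomposition n k (t : 'M[F]_n) : t^T = - t -> (\rank t <= 2 * k)%N ->
  exists U V : 'M[F]_(k, n), t = U^T *m V - V^T *m U.
Proof.
elim: k t => [|k IH] t tT rt.
  exists 0, 0; rewrite !mulmx0 subr0; apply/eqP.
  by rewrite -mxrank_eq0 -leqn0 -[leqRHS](muln0 2).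
have [->|/matrix0Pn[i [j tij]]] := eqVneq t 0.
  by exists 0, 0; rewrite !mulmx0 subr0.
have tN a b : t a b = - t b a by have /matrixP/(_ b a) := tT; rewrite !mxE.
have t0 a := skew_diag0 a tT.
set a := t i j in tij; set u := row i t; set v := row j t.
(* The subtracted matrix agrees with [t] in the rows and columns [i] and [j]. *)
pose t' := t - a^-1 *: (u^T *m v - v^T *m u).
have t'E x y : t' x y = t x y - a^-1 * (t i x * t j y - t j x * t i y).
  by rewrite !(mxE, big_ord1).
have t'T : t'^T = - t'.
  by apply/matrixP => x y; rewrite [LHS]mxE [RHS]mxE !t'E (tN x y); ring.
pose w : 'M[F]_(1 + 1, n) := col_mx u v.
have wi (x : 'rV[F]_(1 + 1)) : (x *m w) 0 i = - (x 0 (rshift 1 0) * a).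
  rewrite -{1}[x]hsubmxK mul_row_col !(mxE, big_ord1) t0 mulr0 add0r.
  by rewrite (tN j i) mulrN.
have wj (x : 'rV[F]_(1 + 1)) : (x *m w) 0 j = x 0 (lshift 1 0) * a.
  by rewrite -{1}[x]hsubmxK mul_row_col !(mxE, big_ord1) t0 mulr0 addr0.
have w_eq0 (x : 'rV[F]_(1 + 1)) : (x *m w) 0 i = 0 -> (x *m w) 0 j = 0 -> x = 0.
  rewrite wi wj => /eqP; rewrite oppr_eq0 mulf_eq0 (negPf tij) orbF => /eqP xr.
  move=> /eqP; rewrite mulf_eq0 (negPf tij) orbF => /eqP xl.
  by apply/rowP => c; rewrite mxE; case: (splitP c) => c' cc';
    rewrite ord1 in cc'; [rewrite -[RHS]xl|rewrite -[RHS]xr];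
    congr (x _ _); apply/val_inj.
have rw : \rank w = 2.
  apply/eqP; rewrite -/(row_free w) -kermx_eq0 -submx0; apply/rV_subP => x.
  rewrite sub_kermx submx0 => /eqP xw; apply/eqP.
  by apply: w_eq0; rewrite xw mxE.
have t'i x : t' x i = 0 by rewrite t'E t0 (tN j i) (tN x i) -/a; field.
have t'j x : t' x j = 0 by rewrite t'E t0 (tN x j) -/a; field.
(* Rows in the span of [t'] vanish at [i] and [j], whereas these two coordinates determine a
   combination of [u] and [v]. *)
have capw : (t' :&: w)%MS = 0.
  apply/eqP; rewrite -submx0; apply/rV_subP => y.
  rewrite sub_capmx => /andP[/submxP[D yD] /submxP[x yx]].
  suff x0 : x = 0 by rewrite yx x0 mul0mx sub0mx.
  apply: w_eq0; rewrite -yx yD mxE big1 // => b _.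
    by rewrite t'i mulr0.
  by rewrite t'j mulr0.
have rt' : (\rank t' + 2 <= \rank t)%N.
  have := mxrank_disjoint_sum capw; rewrite rw => <-; apply: mxrankS.
  have uvt : (u <= t)%MS && (v <= t)%MS by rewrite !row_sub.
  have /andP[ut vt] := uvt.
  rewrite addsmx_sub col_mx_sub uvt andbT addmx_sub ?submx_refl //.
  rewrite eqmx_opp scalemx_sub // addmx_sub ?eqmx_opp //.
    exact: mulmx_sub.
  exact: mulmx_sub.
have [|U [V t'UV]] := IH _ t'T; first lia.
pose U1 : 'M[F]_(1 + k, n) := col_mx (a^-1 *: u) U.
pose V1 : 'M[F]_(1 + k, n) := col_mx v V.
exists U1, V1; change (t = U1^T *m V1 - V1^T *m U1).
rewrite !tr_col_mx !mul_row_col -[LHS](subrK (a^-1 *: (u^T *m v - v^T *m u))).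
rewrite -/t' t'UV linearZ /= -scalemxAl -scalemxAr scalerBr.
by rewrite opprD addrACA; congr (_ + _); exact: addrC.
Qed.

End SkewMatrices.

(* Modulo 2 the matrix is the antidiagonal permutation matrix. *)
Lemma odd_skew_det_neq0 m (A : 'M[int]_m.*2) : A^T = - A ->
  (forall i j : 'I_m.*2, (i < j)%N ->
    exists c : nat, A i j = (c.*2 + (i + j == m.*2.-1))%N%:Z) ->
  \det A != 0.
Proof.
move=> AT AE; apply/eqP => dA.
have AN i j : A i j = - A j i by have /matrixP/(_ j i) := AT; rewrite !mxE.
have : \det (map_mx (intr : int -> 'F_2) A) = 0 by rewrite det_map_mx dA.
have -> : map_mx (intr : int -> 'F_2) A = perm_mx (perm rev_ord_inj).
  have up (i j : 'I_m.*2) : (i < j)%N ->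
      (A i j)%:~R = (i + j == m.*2.-1)%N%:R :> 'F_2.
    move=> /AE[c ->]; rewrite -[_%:~R]/(_%:R) natrD -muln2 natrM.
    by rewrite (_ : 2%:R = 0 :> 'F_2) ?mulr0 ?add0r //; apply/val_inj.
  apply/matrixP => i j; rewrite !mxE permE -val_eqE /=.
  have -> : (m.*2 - i.+1 == j)%N = (i + j == m.*2.-1)%N.
    by have := ltn_ord i; have := ltn_ord j; lia.
  have [ij|ji|ij] := ltngtP i j.
  - exact: up.
  - rewrite AN mulrNz up // addnC; case: eqP => _; last exact: oppr0.
    exact/val_inj.
  - have -> : A i j = 0.
      by have := AN i j; rewrite (val_inj ij); lia.
    rewrite ij (_ : (_ == _) = false) //; have := ltn_ord j; lia.
by rewrite det_perm => /eqP; rewrite signr_eq0.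
Qed.

(** The first [r] rows and columns are kept and the Schur complement of the invertible block [D] is
    made 0. As [R] is the block of the first [r] rows and [- R^T] that of the first [r] columns,
    this is [- R^T *m invmx D *m R]. *)
Lemma skew_completion (F : fieldType) (q r : nat) (le_rq : (r <= q)%N)
    (A : 'M[F]_q) : let w := widen_ord le_rq in
  A^T = - A -> \det (mxsub w w A) != 0 ->
  exists B : 'M[F]_q, [/\ B^T = - B, (\rank B <= r)%N &
    forall i j : 'I_q, (i < r)%N -> B i j = A i j].
Proof.
move=> w AT dA; pose D := mxsub w w A; pose R := rowsub w A.
have uD : D \in unitmx by rewrite unitmxE unitfE.
have DT : D^T = - D.
  by apply/matrixP => i j; have /matrixP/(_ (w i) (w j)) := AT; rewrite !mxE.
have DiT : (invmx D)^T = - invmx D.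
  rewrite trmx_inv DT -scaleN1r invmxZ.
    by rewrite invrN1 scaleN1r.
  by rewrite scaleN1r -DT unitmx_tr.
exists (- (R^T *m invmx D *m R)); split.
- by rewrite linearN /= !trmx_mul trmxK DiT mulNmx mulmxN mulmxA.
- by rewrite mxrank_opp (leq_trans (mxrankM_maxr _ _)) // rank_leq_row.
- move=> i j ir; pose i' := Ordinal ir.
  have iE : i = w i' by apply/val_inj.
  have -> : (- (R^T *m invmx D *m R)) i j = (- (D^T *m invmx D *m R)) i' j.
    rewrite iE !mxE; congr (- _); apply: eq_bigr => x _; congr (_ * _).
    by rewrite !mxE; apply: eq_bigr => y _; rewrite !mxE.
  by rewrite DT mulNmx mulmxV // mulNmx mul1mx opprK iE mxE.
Qed.

(** * Counting the free entries, and matrices with prescribed free entries *)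

Definition upper_index (q r : nat) : finType :=
  {x : 'I_q * 'I_q | (x.1 < x.2)%N && (x.1 < r)%N}.

Lemma card_upper_index q r :
  #|upper_index q r| = (\sum_(i < q | i < r) (q - i.+1))%N.
Proof.
rewrite card_sig -sum1_card.
rewrite (eq_bigl (fun x : 'I_q * 'I_q => (x.1 < r)%N && (x.1 < x.2)%N)); last first.
  by move=> x; rewrite !inE andbC.
rewrite -(pair_big_dep (fun i : 'I_q => (i < r)%N) (fun i j : 'I_q => (i < j)%N)
  (fun _ _ => 1%N)) /=.
apply: eq_bigr => i _.
rewrite -(big_mkord (fun j => i < j)%N (fun=> 1%N)).
transitivity (\sum_(i.+1 <= j < q) 1)%N.
  by rewrite (big_nat_widenl i.+1 0).
by rewrite sum_nat_const_nat muln1.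
Qed.

Lemma card_upper_index_full q r : (q <= r)%N -> #|upper_index q r| = 'C(q, 2).
Proof.
move=> qr; rewrite card_upper_index -triangular_sum big_mkord.
rewrite (eq_bigl predT) => [|i]; last by rewrite (leq_trans _ qr).
rewrite (reindex_inj rev_ord_inj) /=; apply: eq_bigr => i _.
by have := ltn_ord i; lia.
Qed.

Lemma card_upper_index_part q r : (r <= q)%N ->
  (#|upper_index q r| + 'C(r.+1, 2) = r * q)%N.
Proof.
move=> rq; rewrite card_upper_index.
rewrite -(big_mkord (fun i => i < r)%N (fun i => q - i.+1)%N).
rewrite (_ : \sum_(_ <= i < _ | _) _ = \sum_(0 <= i < r) (q - i.+1))%N; last first.
  by rewrite [RHS](big_nat_widen _ _ q).
elim: r rq => [|r IH] rq; first by rewrite big_nil.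
rewrite big_nat_recr //= binS bin1 mulSn -(IH (ltnW rq)); lia.
Qed.

(** The values are even except on the antidiagonal of the leading block, so this block has nonzero
    determinant for every choice of [g] and [skew_completion] applies. *)
Lemma skew_grid_point (F : numFieldType) q k d
    (g : upper_index q k.*2 -> 'I_d.+1) :
  exists t : 'M[F]_q, [/\ t^T = - t, (\rank t <= k.*2)%N &
    forall x : upper_index q k.*2, t (val x).1 (val x).2 =
      ((g x).*2 + ((val x).1 + (val x).2 == k.*2.-1))%N%:R].
Proof.
(* The default 0 serves the pairs [i < j] with [i] beyond the first [k.*2] rows, whose entries the
   completion replaces. *)
pose G (i j : 'I_q) : nat :=
  ((if insub (i, j) is Some x then g x : nat else 0).*2
   + (i + j == k.*2.-1))%N.
pose A : 'M[int]_q := \matrix_(i, j)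
  if (i < j)%N then (G i j)%:Z else if (j < i)%N then - (G j i)%:Z else 0.
have AT : A^T = - A.
  apply/matrixP => i j; rewrite !mxE.
  by case: ltngtP => _; rewrite ?opprK ?oppr0.
have AE (i j : 'I_q) : (i < j)%N -> A i j = G i j by move=> ij; rewrite mxE ij.
pose t0 := map_mx (intr : int -> F) A.
have t0T : t0^T = - t0.
  apply/matrixP => i j; have /matrixP/(_ i j) := AT; rewrite !mxE => ->.
  by rewrite mulrNz.
have t0E (x : upper_index q k.*2) :
    t0 (val x).1 (val x).2 = (G (val x).1 (val x).2)%:R.
  by case: x => -[i j] /= /andP[ij _]; rewrite [LHS]mxE AE.
have GE (x : upper_index q k.*2) : G (val x).1 (val x).2 =
    ((g x).*2 + ((val x).1 + (val x).2 == k.*2.-1))%N.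
  by rewrite /G -surjective_pairing valK.
have [qk|/ltnW kq] := leqP q k.*2.
  exists t0; split=> [//||x]; last by rewrite t0E GE.
  exact: leq_trans (rank_leq_row _) qk.
have [|B [BT rB BE]] := skew_completion (le_rq := kq) t0T.
  set w := widen_ord kq.
  have -> : mxsub w w t0 = map_mx (intr : int -> F) (mxsub w w A).
    by apply/matrixP => i j; rewrite !mxE.
  rewrite det_map_mx intr_eq0; apply: odd_skew_det_neq0 => [|i j ij].
    by apply/matrixP => i j; have /matrixP/(_ (w i) (w j)) := AT; rewrite !mxE.
  rewrite mxE AE //.
  by exists (if insub (w i, w j) is Some x then g x : nat else 0).
exists B; split=> // x; rewrite BE ?t0E ?GE //.
by have /andP[] := valP x.
Qed.

(* [upper_index q k.*2] indexes coordinates that are algebraically independent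
   on the variety of skew matrices of rank at most [2 * k]. *)
Theorem skew_low_rank_kernel (C : numClosedFieldType) (q k h : nat)
    (phi : {linear 'M[C]_q -> 'rV[C]_h}) : ~ countable [set: C] ->
  (h < #|upper_index q k.*2|)%N ->
  exists t : 'M[C]_q,
    [/\ t^T = - t, (\rank t <= k.*2)%N, t != 0 & phi t = 0].
Proof.
move=> C_uncountable hK.
pose mx (y : 'I_q * 'I_q -> C) := \matrix_(i, j) y (i, j).
pose Y := [set y | (mx y)^T = - mx y /\ (\rank (mx y) <= k.*2)%N].
pose l j y := phi (mx y) 0 j.
have mxZ a y : mx (fun i => a * y i) = a *: mx y.
  by apply/matrixP => i j; rewrite !mxE.
have Y_cone a y : Y y -> Y (fun i => a * y i).
  rewrite /Y /= mxZ => -[yT ry]; split; first by rewrite linearZ /= yT scalerN.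
  exact: leq_trans (mxrank_scale _ _) ry.
have l_homog j a y : l j (fun i => a * y i) = a * l j y.
  by rewrite /l mxZ linearZ mxE.
have l_poly j : polyfun 1 (l j).
  apply: (polyfun_eq (f := fun y => \sum_x y x * phi (delta_mx x.1 x.2) 0 j)).
    move=> y; rewrite /l [mx y]matrix_sum_delta pair_big linear_sum summxE.
    by apply: eq_bigr => -[a b] _; rewrite linearZ !mxE.
  by apply: polyfun_sum => x; apply/polyfun_varM/polyfun_cst.
pose v d (x : upper_index q k.*2) (c : 'I_d.+1) : C :=
  (c.*2 + ((val x).1 + (val x).2 == k.*2.-1))%N%:R.
have [|z [[e ze] lz zY]] :=
  cone_linear_section C_uncountable Y_cone l_poly l_homog
    (eps := (val : upper_index q k.*2 -> _)) _ hK.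
  move=> d; exists (@v d) => [x c c' /eqP|g].
    by rewrite eqr_nat eqn_add2r => /eqP /double_inj /val_inj.
  have [t [tT rt tE]] := skew_grid_point C g.
  have mxt : mx (fun x => t x.1 x.2) = t by apply/matrixP => i j; rewrite mxE.
  by exists (fun x => t x.1 x.2) => //; rewrite /Y /= mxt.
exists (mx z); split.
- apply/matrixP => i j; rewrite !mxE; apply/eqP; rewrite -addr_eq0; apply/eqP.
  apply: (zY 1%N (fun y => y (j, i) + y (i, j))).
    by apply: polyfun_add; apply: polyfun_var.
  by move=> y [/matrixP/(_ i j) + _]; rewrite !mxE => ->; rewrite addNr.
(* A nonzero minor of size above [k.*2] would be a polynomial that vanishes on [Y] but not at
   [z]. *)
- rewrite leqNgt; apply/negP => rz.
  have [f [g]] := nonzero_minor (mx z); move: (\rank _) rz f g => r rz f g.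
  move=> /eqP; apply.
  have pdet : polyfun r (fun y => \det (mxsub f g (mx y))).
    apply: polyfun_sum => s; apply: polyfunZ.
    rewrite -[X in polyfun X]card_ord -sum1_card.
    apply: (polyfun_eq (f := fun y => \prod_i y (f i, g (s i)))).
      by move=> y; apply: eq_bigr => i _; rewrite !mxE.
    by apply: polyfun_prod => i; apply: polyfun_var.
  apply: (zY _ _ pdet) => y [_ ry]; apply/eqP; apply: contraTT rz.
  rewrite -unitfE -unitmxE -row_free_unit => /eqP rE.
  by rewrite -leqNgt -rE (leq_trans (mxrank_mxsub _ _ _)).
- by case: e ze => i j; apply: contra_neq => /matrixP/(_ i j); rewrite !mxE.
- by apply/rowP => j; rewrite [RHS]mxE; apply: lz.
Qed.

(** * The wedge map *)

(** Exactness is given for subspaces of dimension exactly [k], whereas the [k] rows of a matrix may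
    be dependent. *)
Lemma vspace_extend (K : fieldType) (vT : vectType K) (U : {vspace vT}) k :
  (\dim U <= k <= \dim {:vT})%N -> exists2 W : {vspace vT}, (U <= W)%VS & \dim W = k.
Proof.
case/andP; move: (leqnn (k - \dim U)); move: {2}(k - _)%N => n.
elim: n U => [|n IH] U kn Uk kT.
  by exists U => //; apply/eqP; rewrite eqn_leq Uk /=; rewrite leqn0 subn_eq0 in kn.
have [kU|Uk'] := leqP k (\dim U).
  by exists U => //; apply/eqP; rewrite eqn_leq Uk.
have [w wU] : exists w, w \notin U.
  apply: contrapT => /forallNP inU.
  have : (fullv <= U)%VS by apply/subvP => w _; apply/negPn/negP/inU.
  by move=> /dimvS; lia.
have dw : \dim (U + <[w]>) = (\dim U).+1.
  rewrite dimv_disjoint_sum ?dim_vline.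
    by rewrite (contraNneq _ wU) ?addn1 // => ->; rewrite mem0v.
  apply/eqP; rewrite -subv0; apply/subvP => x.
  rewrite memv_cap => /andP[xU /vlineP[a xa]]; rewrite memv0 xa.
  have [->|a0] := eqVneq a 0; first by rewrite scale0r.
  by case/negP: wU; rewrite -(scalerK a0 w) memvZ -?xa.
have [||| W UW dW] := IH (U + <[w]>)%VS; rewrite ?dw //; first lia.
by exists W => //; apply: subv_trans UW; apply: addvSl.
Qed.

Lemma tensor_mem (R : realType) q (U V : {vspace 'rV[CC R]_q}) u v :
  u \in U -> v \in V -> u^T *m v \in tensor U V.
Proof.
move=> uU vV; rewrite (coord_vbasis uU) (coord_vbasis vV) (linear_sum trmx) /=.
rewrite mulmx_suml memv_suml // => i _; rewrite mulmx_sumr memv_suml // => j _.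
rewrite -scalemxAr linearZ /= -scalemxAl !memvZ // memv_span //.
by apply: allpairs_f; apply: mem_nth; rewrite size_tuple.
Qed.

Section Coordinates.
Context {R : realType} {n : nat} (X : cmanifold R n).
Local Notation C := (CC R).
Context (M : lmodType C) (P : set (cfield X M)) (d : nat).
Context (b : 'I_d -> cfield X M).
Hypothesis P0 : P (fun _ _ => 0).
Hypothesis bP : is_basis P b.

(** Uniqueness of the coordinates of the zero field suffices, so closure of [P] under linear
    combinations never has to be checked. *)
Lemma lincomb_inj (c c' : 'rV[C]_d) : lincomb b c = lincomb b c' -> c = c'.
Proof.
move=> cc'; have [c0 [_ c0E]] := bP.2 _ P0.
have e0 : c0 = 0.
  apply: c0E; apply/funext => i; apply/funext => z.
  by rewrite /lincomb big1 // => j _; rewrite mxE scale0r.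
apply/eqP; rewrite -subr_eq0 -e0; apply/eqP/esym/c0E.
apply/funext => i; apply/funext => z; rewrite /lincomb.
under eq_bigr => j _ do rewrite !mxE scalerBl.
rewrite sumrB.
have := congr1 (fun f => f i z) cc'; rewrite /lincomb => ->.
by rewrite subrr.
Qed.

Lemma coords_eq e c : e = lincomb b c -> coords b e = c.
Proof.
move=> ec; apply: lincomb_inj; rewrite -ec.
have := @xgetPex _ 0 [set c | e = lincomb b c]; rewrite /coords /= => <- //.
by exists c.
Qed.

(** Outside the span of [b] both sides are the default 0, so the identity applies to wedge products
    without first proving them holomorphic. *)
Lemma coordsN e : coords b (fun i z => - e i z) = - coords b e.
Proof.
have lcN c : (fun i z => - lincomb b c i z) = lincomb b (- c).
  apply/funext => i; apply/funext => z; rewrite /lincomb -sumrN.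
  by apply: eq_bigr => j _; rewrite mxE scaleNr.
have [[c ec]|noc] := pselect (exists c, e = lincomb b c).
  by rewrite (coords_eq ec); apply: coords_eq; rewrite ec lcN.
rewrite [coords b e]/coords [LHS]/coords !xgetPN ?oppr0 // => c ec.
  by apply: noc; exists c.
apply: noc; exists (- c); rewrite -lcN -ec.
by apply/funext => i; apply/funext => z; rewrite opprK.
Qed.

End Coordinates.

Section WedgeMap.
Context {R : realType} {n : nat} {X : cmanifold R n} {q h : nat}.
Local Notation C := (CC R).
Context (alpha : 'I_q -> cfield X 'cV[C]_n) (beta : 'I_h -> cfield X 'M[C]_n).

(** The function under [linfun] in [wedge_map], named so that it can carry the linear structure that
    evaluating [linfun] requires. *)
Definition wedge_fun (t : 'M[C]_q) : 'rV[C]_h :=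
  \sum_i \sum_j t i j *: coords beta (wedge (alpha i) (alpha j)).

Lemma wedge_fun_is_linear : linear wedge_fun.
Proof.
move=> a s t; rewrite /wedge_fun scaler_sumr -big_split; apply: eq_bigr => i _.
rewrite scaler_sumr -big_split; apply: eq_bigr => j _.
by rewrite !mxE scalerDl scalerA.
Qed.

HB.instance Definition _ :=
  GRing.isLinear.Build C 'M[C]_q 'rV[C]_h _ wedge_fun wedge_fun_is_linear.

Lemma wedge_mapE t : wedge_map alpha beta t = wedge_fun t.
Proof. exact: (lfunE wedge_fun). Qed.

Definition sym_fun (t : 'M[C]_q) : 'M[C]_q := t + t^T.

Lemma sym_fun_is_linear : linear sym_fun.
Proof. by move=> a s t; rewrite /sym_fun linearP scalerDr addrACA. Qed.

HB.instance Definition _ :=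
  GRing.isLinear.Build C 'M[C]_q 'M[C]_q _ sym_fun sym_fun_is_linear.

Lemma sym_mapE t : @sym_map R q t = t + t^T.
Proof. exact: (lfunE sym_fun). Qed.

Lemma holo_form2_0 : holo_form2 (fun (i : cidx X) (_ : 'rV[C]_n) => 0).
Proof.
by split=> [i z|i z _|i z _|i j z _] //; rewrite ?linear0 ?oppr0 ?mulmx0 ?mul0mx.
Qed.

Hypothesis beta_basis : is_basis (@holo_form2 R n X) beta.

Lemma wedge_fun_tr t : wedge_fun t^T = - wedge_fun t.
Proof.
rewrite /wedge_fun exchange_big -sumrN; apply: eq_bigr => i _.
rewrite -sumrN; apply: eq_bigr => j _; rewrite mxE -scalerN.
rewrite -(coordsN holo_form2_0 beta_basis); congr (_ *: coords beta _).
by apply/funext => x; apply/funext => z; rewrite /wedge opprB.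
Qed.

Lemma exact_skew_eq0 k (t : 'M[C]_q) : (k <= q)%N ->
  (forall W : Gr R k q, exact_at alpha beta (subsp W)) ->
  t^T = - t -> (\rank t <= k.*2)%N -> wedge_fun t = 0 -> t = 0.
Proof.
move=> kq exactness tT; rewrite -mul2n => rt t0.
have two0 : (2 : C) != 0 by rewrite pnatr_eq0.
have [U [V tUV]] := skew_decomposition two0 tT rt.
have [|W UW dW] := @vspace_extend _ _ (rowspan U) k.
  rewrite dimvf /dim /= mul1n kq andbT.
  by apply: leq_trans (dim_span _) _; rewrite size_map size_enum_ord.
have dWk : \dim W == k by apply/eqP.
have [_ ex] := exactness (exist _ W dWk).
pose s := U^T *m V.
have sT : s^T = V^T *m U by rewrite trmx_mul trmxK.
have tE : t = s - s^T by rewrite sT.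
(* The wedge map changes sign under transposition, so it sends [t = s - s^T] to twice the image of
   [s]. *)
have s0 : wedge_fun s = 0.
  have : wedge_fun t = 2 *: wedge_fun s.
    by rewrite tE linearB /= wedge_fun_tr opprK scaler_nat mulr2n.
  by rewrite t0 => /esym/eqP; rewrite scaler_eq0 (negPf two0) => /eqP.
have sW : s \in tensor W fullv.
  rewrite /s (_ : U^T *m V = \sum_i (row i U)^T *m row i V).
    apply: memv_suml => i _; apply: tensor_mem; last exact: memvf.
    by apply: (subvP UW); apply: memv_span; apply: map_f; rewrite mem_enum.
  apply/matrixP => a b; rewrite summxE mxE; apply: eq_bigr => i _.
  by rewrite !(mxE, big_ord1).
(* Exactness at W (x) V: [s] has the form [u + u^T], hence is symmetric. *)
have : s \in (sym_map @: tensor W W)%VS.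
  by rewrite -ex memv_cap sW andbT memv_ker wedge_mapE s0.
case/memv_imgP => u _; rewrite sym_mapE => su.
by rewrite tE su linearD /= trmxK [u^T + u]addrC subrr.
Qed.

End WedgeMap.

Theorem proposition4p3 (R : realType) (n : nat) (X : cmanifold R n)
  (X_connected : connected [set: X]) (X_kaehler : compact_kaehler X)
  (q h20 k : nat)
  (alpha : 'I_q -> cfield X 'cV[CC R]_n)
  (beta : 'I_h20 -> cfield X 'M[CC R]_n)
  (alpha_basis : is_basis (@holo_form1 R n X) alpha)
  (beta_basis : is_basis (@holo_form2 R n X) beta)
  (k_bounds : (1 <= k <= q)%N)
  (exactness : forall W : Gr R k q, exact_at alpha beta (subsp W))
  (v : q.-tuple 'rV[CC R]_q) (v_basis : basis_of fullv v)
  (sigma : {ffun 'I_k -> 'I_(q - k).+1} -> cochain R (Gr R k q))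
  (sigma_schubert : forall l, is_part l ->
    cycle_class (schubert v l) (part_size l) (sigma l))
  (c : cochain R (Gr R k q))
  (c_chern : total_chern_class
    (fun W : Gr R k q => image_at alpha beta (subsp W)) c)
  (a : {ffun 'I_k -> 'I_(q - k).+1} -> int)
  (c_expansion : cohomologous setT c
    (cochain_lincomb (@is_part k (q - k)) a sigma))
  (a_bigger : forall l, is_part l -> part_bigger l (mu k q) -> a l = 0)
  (a_mu : a (mu k q) <> 0) :
  ((q <= 2 * k)%N -> ('C(q, 2) <= h20)%N) /\
  ((2 * k <= q)%N -> (2 * k * q - 'C(2 * k + 1, 2) <= h20)%N).
Proof.
have kq : (k <= q)%N by case/andP: k_bounds.
(* With fewer 2-forms than free entries, the wedge map would kill a nonzero skew matrix of rank at
   most [k.*2], against [exact_skew_eq0]. *)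
have Kh : (#|upper_index q k.*2| <= h20)%N.
  rewrite leqNgt; apply/negP => /(skew_low_rank_kernel (wedge_fun alpha beta)).
  move=> /(_ (@complex_uncountable R))[t [tT rt /eqP t0 tw]].
  exact: t0 (exact_skew_eq0 beta_basis kq exactness tT rt tw).
rewrite mul2n addn1; split=> kq2.
  by rewrite -(card_upper_index_full kq2).
by rewrite -(card_upper_index_part kq2) addnK.
Qed.
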